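(* Let $k\ge 6$ and let $X$ be a compact complex with $SD_2^{\ast}(k)$ links. Then every finitely presented subgroup of $\pi_1(X)$ is the fundamental group of a finite complex with $SD_2^{\ast}(k)$ links.
   Context: Conventions: $X$ is a connected simplicial complex. $X$ is flag if every finite set of pairwise adjacent vertices spans a simplex. The link $X_\sigma$ of a simplex $\sigma$ is the subcomplex of simplices $\tau$ disjoint from $\sigma$ with $\tau\cup\sigma$ spanning a simplex. $B_1(v,X)$ is the full subcomplex spanned by $v$ and the vertices adjacent to $v$. Wheels: for $k\ge4$ a $k$-wheel $(v_0;v_1,\dots,v_k)$ in a complex is a full subcomplex such that $(v_1,\dots,v_k,v_1)$ is a full $k$-cycle (distinct vertices, cyclically consecutive ones adjacent, no other adjacencies among them) and $v_0$ is adjacent to all $v_1,\dots,v_k$. A $k$-wheel with a pendant triangle is the union of a $k$-wheel and a triangle $\langle v_1,v_2,t\rangle$ of the complex with $t\neq v_i$ for $i=0,\dots,k$ (not required to be full). A flag complex $X$ (connected or not) satisfies $SD_2^{\ast}(k)$ ($k\ge5$) if it has no $4$-wheels, and for $5\le l<k$ every $l$-wheel with a pendant triangle $\widehat W$ in $X$ is contained in $B_1(v,X)$ for some vertex $v$ of $X$. A flag simplicial complex $X$ is a complex with $SD_2^{\ast}(k)$ links if $X$ and every link of $X$ satisfy $SD_2^{\ast}(k)$. *)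

(* Defs.v *)
From HB Require Import structures.
From mathcomp Require Import all_boot finmap all_classical.

Set Implicit Arguments.
Unset Strict Implicit.
Unset Printing Implicit Defensive.

Local Open Scope fset_scope.
Local Open Scope quotient_scope.

(* Abstract simplicial complexes, possibly infinite.  Simplices are nonempty;
   the vertices are the v with [fset v] a simplex, so that elements of V need
   not all be vertices and links live on the same type V. *)
Record complex (V : choiceType) := Complex {
  face : {fset V} -> Prop;
  face_neq0 : forall s, face s -> s != fset0;
  face_sub : forall s t, face s -> t `<=` s -> t != fset0 -> face t }.

Definition vertex (V : choiceType) (X : complex V) (v : V) : Prop :=
  face X [fset v].

Definition adj (V : choiceType) (X : complex V) (u v : V) : Prop :=
  u != v /\ face X [fset u; v].

Definition flag (V : choiceType) (X : complex V) : Prop :=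
  forall s : {fset V}, s != fset0 ->
    (forall v, v \in s -> vertex X v) ->
    (forall u v, u \in s -> v \in s -> u != v -> adj X u v) ->
    face X s.

(* A simplicial complex is compact iff it has finitely many simplices. *)
Definition finite_complex (V : choiceType) (X : complex V) : Prop :=
  finite_set (face X : set {fset V}).

Definition subcomplex (V : choiceType) (A X : complex V) : Prop :=
  forall s, face A s -> face X s.

Lemma link_neq0 (V : choiceType) (X : complex V) (sigma s : {fset V}) :
  [/\ s != fset0, [disjoint s & sigma] & face X (s `|` sigma)] -> s != fset0.
Proof. by case. Qed.

Lemma link_sub (V : choiceType) (X : complex V) (sigma s t : {fset V}) :
  [/\ s != fset0, [disjoint s & sigma] & face X (s `|` sigma)] ->
  t `<=` s -> t != fset0 ->
  [/\ t != fset0, [disjoint t & sigma] & face X (t `|` sigma)].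
Proof.
move=> [_ dis fs] ts t0; split=> //.
  by apply: fdisjointWl ts dis.
apply: (face_sub fs); first exact: fsetSU.
by case/fset0Pn: t0 => x xt; apply/fset0Pn; exists x; rewrite inE xt.
Qed.

Definition link (V : choiceType) (X : complex V) (sigma : {fset V}) :
    complex V :=
  Complex (@link_neq0 V X sigma) (@link_sub V X sigma).

Lemma full_neq0 (V : choiceType) (X : complex V) (A : V -> Prop) s :
  face X s /\ (forall v, v \in s -> A v) -> s != fset0.
Proof. by case=> /face_neq0. Qed.

Lemma full_sub (V : choiceType) (X : complex V) (A : V -> Prop) s t :
  face X s /\ (forall v, v \in s -> A v) -> t `<=` s -> t != fset0 ->
  face X t /\ (forall v, v \in t -> A v).
Proof.
move=> [fs sA] ts t0; split; first exact: face_sub fs ts t0.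
by move=> v vt; apply: sA; apply: (fsubsetP ts).
Qed.

Definition full_subcomplex (V : choiceType) (X : complex V) (A : V -> Prop) :
    complex V :=
  Complex (@full_neq0 V X A) (@full_sub V X A).

Definition ball1 (V : choiceType) (v : V) (X : complex V) : complex V :=
  full_subcomplex X (fun u => u = v \/ adj X v u).

Lemma simplex_neq0 (V : choiceType) (s t : {fset V}) :
  t != fset0 /\ t `<=` s -> t != fset0.
Proof. by case. Qed.

Lemma simplex_sub (V : choiceType) (s t u : {fset V}) :
  t != fset0 /\ t `<=` s -> u `<=` t -> u != fset0 ->
  u != fset0 /\ u `<=` s.
Proof. by move=> [_ ts] ut u0; split=> //; apply: fsubset_trans ts. Qed.

Definition simplex (V : choiceType) (s : {fset V}) : complex V :=
  Complex (@simplex_neq0 V s) (@simplex_sub V s).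

Lemma union_neq0 (V : choiceType) (A B : complex V) s :
  face A s \/ face B s -> s != fset0.
Proof. by case=> /face_neq0. Qed.

Lemma union_sub (V : choiceType) (A B : complex V) s t :
  face A s \/ face B s -> t `<=` s -> t != fset0 -> face A t \/ face B t.
Proof. by case=> fs ts t0; [left|right]; apply: face_sub fs ts t0. Qed.

Definition complex_union (V : choiceType) (A B : complex V) : complex V :=
  Complex (@union_neq0 V A B) (@union_sub V A B).

(* A wheel (v_0; v_1, ..., v_k) is given by v : nat -> V, of which only the
   values v 0, ..., v k are used. *)
Definition full_cycle (V : choiceType) (X : complex V) (k : nat)
    (v : nat -> V) : Prop :=
  forall i j, 1 <= i <= k -> 1 <= j <= k ->
    (v i = v j -> i = j) /\
    (adj X (v i) (v j) <->
     [\/ j = i.+1, i = j.+1, i = 1 /\ j = k | i = k /\ j = 1]).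

Definition is_wheel (V : choiceType) (X : complex V) (k : nat)
    (v : nat -> V) : Prop :=
  full_cycle X k v /\ (forall i, 1 <= i <= k -> adj X (v 0) (v i)).

Definition wheel (V : choiceType) (X : complex V) (k : nat) (v : nat -> V) :
    complex V :=
  full_subcomplex X (fun u => exists2 i, i <= k & u = v i).

Definition is_pendant (V : choiceType) (X : complex V) (k : nat)
    (v : nat -> V) (t : V) : Prop :=
  (forall i, i <= k -> t <> v i) /\ face X [fset v 1; v 2; t].

Definition pendant_wheel (V : choiceType) (X : complex V) (k : nat)
    (v : nat -> V) (t : V) : complex V :=
  complex_union (wheel X k v) (simplex [fset v 1; v 2; t]).

Definition SD2star (k : nat) (V : choiceType) (X : complex V) : Prop :=
  [/\ flag X,
      (forall v, ~ is_wheel X 4 v) &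
      (forall l v t, 5 <= l < k -> is_wheel X l v -> is_pendant X l v t ->
         exists2 u, vertex X u & subcomplex (pendant_wheel X l v t) (ball1 u X))].

Definition SD2star_links (k : nat) (V : choiceType) (X : complex V) : Prop :=
  SD2star k X /\ (forall sigma, face X sigma -> SD2star k (link X sigma)).

(* Edge paths, as sequences of vertices in which consecutive ones are equal or
   adjacent; homotopy is generated by removing a repetition and by replacing
   two consecutive edges a b, b c of a (possibly degenerate) simplex {a, b, c}
   by a c. *)
Definition edge (V : choiceType) (X : complex V) : rel V :=
  fun u v => `[< face X [fset u; v] >].

Definition connected (V : choiceType) (X : complex V) : Prop :=
  (exists v, vertex X v) /\
  (forall u v, vertex X u -> vertex X v ->
     exists2 p, path (edge X) u p & last u p = v).

Inductive homotopic (V : choiceType) (X : complex V) :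
    seq V -> seq V -> Prop :=
| homotopic_refl s : homotopic X s s
| homotopic_sym s t : homotopic X s t -> homotopic X t s
| homotopic_trans s t u :
    homotopic X s t -> homotopic X t u -> homotopic X s u
| homotopic_repeat p a q : homotopic X (p ++ a :: a :: q) (p ++ a :: q)
| homotopic_triangle p a b c q : face X [fset a; b; c] ->
    homotopic X (p ++ a :: b :: c :: q) (p ++ a :: c :: q).

(* The edge loop x, p_1, ..., p_n = x is represented by p = [:: p_1; ..; p_n]. *)
Definition is_loop (V : choiceType) (X : complex V) (x : V) (p : seq V) :
    bool :=
  path (edge X) x p && (last x p == x).

Definition loop (V : choiceType) (X : complex V) (x : V) : Type :=
  {p : seq V | is_loop X x p}.

HB.instance Definition _ (V : choiceType) (X : complex V) (x : V) :=
  Choice.on (loop X x).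

Definition loop_eq (V : choiceType) (X : complex V) (x : V) :
    rel (loop X x) :=
  fun p q => `[< homotopic X (x :: val p) (x :: val q) >].

Lemma loop_eq_refl (V : choiceType) (X : complex V) (x : V) :
  reflexive (@loop_eq V X x).
Proof. by move=> p; apply/asboolP; apply: homotopic_refl. Qed.

Lemma loop_eq_sym (V : choiceType) (X : complex V) (x : V) :
  symmetric (@loop_eq V X x).
Proof. by move=> p q; apply/asboolP/asboolP; apply: homotopic_sym. Qed.

Lemma loop_eq_trans (V : choiceType) (X : complex V) (x : V) :
  transitive (@loop_eq V X x).
Proof.
by move=> q p r /asboolP pq /asboolP qr; apply/asboolP;
  apply: homotopic_trans qr.
Qed.

Canonical loop_equiv (V : choiceType) (X : complex V) (x : V) :=
  EquivRel (@loop_eq V X x) (@loop_eq_refl V X x) (@loop_eq_sym V X x)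
    (@loop_eq_trans V X x).

(* The fundamental group is the edge-path group: edge loops at x up to
   homotopy, multiplied by concatenation. *)
Definition pi1 (V : choiceType) (X : complex V) (x : V) : Type :=
  {eq_quot (loop_equiv X x)}.

HB.instance Definition _ (V : choiceType) (X : complex V) (x : V) :=
  Choice.on (pi1 X x).
HB.instance Definition _ (V : choiceType) (X : complex V) (x : V) :=
  EqQuotient.on (pi1 X x).

Lemma edgeC (V : choiceType) (X : complex V) : symmetric (edge X).
Proof. by move=> u v; rewrite /edge fsetUC. Qed.

Lemma homotopic_cat (V : choiceType) (X : complex V) u s t w :
  homotopic X s t -> homotopic X (u ++ s ++ w) (u ++ t ++ w).
Proof.
elim=> [{}s|{}s {}t _|{}s {}t r _ + _|p a q|p a b c q abc].
- exact: homotopic_refl.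
- exact: homotopic_sym.
- exact: homotopic_trans.
- by rewrite -!catA !catA -!(catA (u ++ p)) /=; apply: homotopic_repeat.
- by rewrite -!catA !catA -!(catA (u ++ p)) /=; apply: homotopic_triangle.
Qed.

Lemma homotopic_rev (V : choiceType) (X : complex V) s t :
  homotopic X s t -> homotopic X (rev s) (rev t).
Proof.
elim=> [{}s|{}s {}t _|{}s {}t r _ + _|p a q|p a b c q abc].
- exact: homotopic_refl.
- exact: homotopic_sym.
- exact: homotopic_trans.
- by rewrite !rev_cat !rev_cons -!cats1 -!catA; apply: homotopic_repeat.
- rewrite !rev_cat !rev_cons -!cats1 -!catA /=; apply: homotopic_triangle.
  suff -> : [fset c; b; a] = [fset a; b; c] by [].
  by apply/fsetP=> v; rewrite !inE orbC orbA orbAC.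
Qed.

Lemma face2 (V : choiceType) (X : complex V) u v :
  edge X u v -> face X [fset u; v; u].
Proof.
move=> /asboolP uv; suff -> : [fset u; v; u] = [fset u; v] by [].
by apply/fsetP=> w; rewrite !inE orbAC orbb.
Qed.

Lemma homotopic_backtrack (V : choiceType) (X : complex V) x p :
  path (edge X) x p -> homotopic X (x :: p ++ rev (belast x p)) [:: x].
Proof.
elim: p x => [|y p IH] x /=; first by move=> _; apply: homotopic_refl.
move=> /andP[xy /IH /(homotopic_cat [:: x] [:: x])].
rewrite /= -catA /= cats1 -rev_cons => h.
apply: homotopic_trans h _.
apply: homotopic_trans (homotopic_triangle [::] [::] (face2 xy)) _.
exact: homotopic_repeat [::] x [::].
Qed.

Lemma is_loop_nil (V : choiceType) (X : complex V) x : is_loop X x [::].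
Proof. by rewrite /is_loop /= eqxx. Qed.

Lemma is_loop_cat (V : choiceType) (X : complex V) x p q :
  is_loop X x p -> is_loop X x q -> is_loop X x (p ++ q).
Proof.
move=> /andP[pp /eqP lp] /andP[pq lq].
by rewrite /is_loop cat_path last_cat lp pp pq.
Qed.

Lemma is_loop_rev (V : choiceType) (X : complex V) x p :
  is_loop X x p -> is_loop X x (rev (belast x p)).
Proof.
move=> /andP[pp /eqP lp]; apply/andP; split.
  by rewrite -{1}lp rev_path (eq_path (e' := edge X)) // => u v; rewrite edgeC.
by case: p {pp} lp => [|y p] //= _; rewrite rev_cons last_rcons.
Qed.

Definition loop_one (V : choiceType) (X : complex V) (x : V) : loop X x :=
  exist _ [::] (is_loop_nil X x).

Definition loop_mul (V : choiceType) (X : complex V) (x : V)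
    (p q : loop X x) : loop X x :=
  exist _ (val p ++ val q) (is_loop_cat (valP p) (valP q)).

Definition loop_inv (V : choiceType) (X : complex V) (x : V) (p : loop X x) :
    loop X x :=
  exist _ (rev (belast x (val p))) (is_loop_rev (valP p)).

Definition pi1_one (V : choiceType) (X : complex V) (x : V) : pi1 X x :=
  \pi_(pi1 X x) (loop_one X x).

Definition pi1_mul (V : choiceType) (X : complex V) (x : V)
    (a b : pi1 X x) : pi1 X x :=
  \pi_(pi1 X x) (loop_mul (repr a) (repr b)).

Definition pi1_inv (V : choiceType) (X : complex V) (x : V) (a : pi1 X x) :
    pi1 X x :=
  \pi_(pi1 X x) (loop_inv (repr a)).

Lemma pi1P (V : choiceType) (X : complex V) (x : V) (p q : loop X x) :
  homotopic X (x :: val p) (x :: val q) <-> \pi_(pi1 X x) p = \pi q.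
Proof.
split; first by move=> h; apply/eqquotP; apply/asboolP.
by move=> /eqquotP /asboolP.
Qed.

Lemma loop_rcons (V : choiceType) (X : complex V) (x : V) (p : loop X x) :
  x :: val p = rcons (belast x (val p)) x.
Proof. by rewrite lastI (eqP (proj2 (andP (valP p)))). Qed.

Lemma pi1_mulE (V : choiceType) (X : complex V) (x : V) (p q : loop X x) :
  pi1_mul (\pi p) (\pi q) = \pi_(pi1 X x) (loop_mul p q).
Proof.
have /pi1P hp : \pi_(pi1 X x) (repr (\pi_(pi1 X x) p)) = \pi p
  by rewrite reprK.
have /pi1P hq : \pi_(pi1 X x) (repr (\pi_(pi1 X x) q)) = \pi q
  by rewrite reprK.
apply/pi1P; rewrite /= -!cat_cons.
apply: homotopic_trans (homotopic_cat [::] _ hp) _.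
rewrite loop_rcons !cat_rcons.
by have := homotopic_cat (belast x (val p)) [::] hq; rewrite !cats0.
Qed.

Lemma pi1_invE (V : choiceType) (X : complex V) (x : V) (p : loop X x) :
  pi1_inv (\pi p) = \pi_(pi1 X x) (loop_inv p).
Proof.
have /pi1P hp : \pi_(pi1 X x) (repr (\pi_(pi1 X x) p)) = \pi p
  by rewrite reprK.
apply/pi1P => /=.
by have := homotopic_rev hp; rewrite !loop_rcons !rev_rcons.
Qed.

Lemma pi1_mulA (V : choiceType) (X : complex V) (x : V) :
  associative (@pi1_mul V X x).
Proof.
elim/quotW=> p; elim/quotW=> q; elim/quotW=> r; rewrite !pi1_mulE.
by congr (\pi_(pi1 X x) _); apply: val_inj; rewrite /= catA.
Qed.

Lemma pi1_mul1g (V : choiceType) (X : complex V) (x : V) :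
  left_id (pi1_one X x) (@pi1_mul V X x).
Proof.
elim/quotW=> p; rewrite pi1_mulE.
by congr (\pi_(pi1 X x) _); apply: val_inj.
Qed.

Lemma pi1_mulg1 (V : choiceType) (X : complex V) (x : V) :
  right_id (pi1_one X x) (@pi1_mul V X x).
Proof.
elim/quotW=> p; rewrite pi1_mulE.
by congr (\pi_(pi1 X x) _); apply: val_inj; rewrite /= cats0.
Qed.

Lemma pi1_mulgV (V : choiceType) (X : complex V) (x : V) :
  right_inverse (pi1_one X x) (@pi1_inv V X x) (@pi1_mul V X x).
Proof.
elim/quotW=> p; rewrite pi1_invE pi1_mulE; apply/pi1P.
exact: homotopic_backtrack (proj1 (andP (valP p))).
Qed.

Lemma loop_invK (V : choiceType) (X : complex V) (x : V) :
  involutive (@loop_inv V X x).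
Proof.
move=> p; apply: val_inj => /=.
have := congr1 rev (loop_rcons (loop_inv p)).
by rewrite rev_cons rev_rcons /= revK -loop_rcons => -[].
Qed.

Lemma pi1_mulVg (V : choiceType) (X : complex V) (x : V) :
  left_inverse (pi1_one X x) (@pi1_inv V X x) (@pi1_mul V X x).
Proof.
elim/quotW=> p; rewrite pi1_invE -[X in pi1_mul _ (\pi_(_) X)]loop_invK.
by rewrite -[X in pi1_mul _ X]pi1_invE pi1_mulgV.
Qed.

HB.instance Definition _ (V : choiceType) (X : complex V) (x : V) :=
  isGroup.Build (pi1 X x) (@pi1_mulA V X x) (@pi1_mul1g V X x)
    (@pi1_mulg1 V X x) (@pi1_mulVg V X x) (@pi1_mulgV V X x).

(* Words in the generators x_i, i : 'I_n, and their formal inverses: the letter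
   (i, false) stands for x_i and (i, true) for its inverse. *)
Definition word (n : nat) : Type := seq ('I_n * bool).

HB.instance Definition _ (n : nat) := Choice.on (word n).

Definition letter_inv (n : nat) (a : 'I_n * bool) : 'I_n * bool :=
  (a.1, ~~ a.2).

Definition word_inv (n : nat) (w : word n) : word n :=
  rev (map (@letter_inv n) w).

(* Equality of words in the group with generators x_i and relators in R. *)
Inductive presents_eq (n : nat) (R : seq (word n)) : word n -> word n -> Prop :=
| presents_refl s : presents_eq R s s
| presents_sym s t : presents_eq R s t -> presents_eq R t s
| presents_trans s t u :
    presents_eq R s t -> presents_eq R t u -> presents_eq R s u
| presents_cancel u a v :
    presents_eq R (u ++ a :: letter_inv a :: v) (u ++ v)
| presents_relator u r v : r \in R -> presents_eq R (u ++ r ++ v) (u ++ v).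

Definition word_eq (n : nat) (R : seq (word n)) : rel (word n) :=
  fun s t => `[< presents_eq R s t >].

Lemma word_eq_refl (n : nat) (R : seq (word n)) : reflexive (word_eq R).
Proof. by move=> s; apply/asboolP; apply: presents_refl. Qed.

Lemma word_eq_sym (n : nat) (R : seq (word n)) : symmetric (word_eq R).
Proof. by move=> s t; apply/asboolP/asboolP; apply: presents_sym. Qed.

Lemma word_eq_trans (n : nat) (R : seq (word n)) : transitive (word_eq R).
Proof.
by move=> t s u /asboolP st /asboolP tu; apply/asboolP;
  apply: presents_trans tu.
Qed.

Canonical word_equiv (n : nat) (R : seq (word n)) :=
  EquivRel (word_eq R) (@word_eq_refl n R) (@word_eq_sym n R)
    (@word_eq_trans n R).

(* The group < x_i, i : 'I_n | R >. *)
Definition presented (n : nat) (R : seq (word n)) : Type :=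
  {eq_quot (word_equiv R)}.

HB.instance Definition _ (n : nat) (R : seq (word n)) :=
  Choice.on (presented R).
HB.instance Definition _ (n : nat) (R : seq (word n)) :=
  EqQuotient.on (presented R).

Lemma letter_invK (n : nat) : involutive (@letter_inv n).
Proof. by case=> i b; rewrite /letter_inv /= negbK. Qed.

Lemma word_invK (n : nat) : involutive (@word_inv n).
Proof.
move=> w; rewrite /word_inv map_rev revK -map_comp.
by rewrite (eq_map (g := id)) ?map_id //; apply: letter_invK.
Qed.

Lemma presents_cat (n : nat) (R : seq (word n)) (u s t w : word n) :
  presents_eq R s t -> presents_eq R (u ++ s ++ w) (u ++ t ++ w).
Proof.
elim=> [{}s|{}s {}t _|{}s {}t r _ + _|p a q|p r q rR].
- exact: presents_refl.
- exact: presents_sym.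
- exact: presents_trans.
- by rewrite -!catA !catA -!(catA (u ++ p)) /=; apply: presents_cancel.
- rewrite -!catA (catA u p) (catA u p (q ++ w)).
  exact: presents_relator.
Qed.

Lemma presents_inv_r (n : nat) (R : seq (word n)) (w : word n) :
  presents_eq R (w ++ word_inv w) [::].
Proof.
elim: w => [|a w IH]; first exact: presents_refl.
rewrite /word_inv /= rev_cons -cats1 catA -/(word_inv w).
apply: presents_trans (presents_cat [:: a] [:: letter_inv a] IH) _.
exact: (presents_cancel R [::] a [::]).
Qed.

Lemma presents_inv_l (n : nat) (R : seq (word n)) (w : word n) :
  presents_eq R (word_inv w ++ w) [::].
Proof. by rewrite -{2}(word_invK w); apply: presents_inv_r. Qed.

Lemma presents_mul (n : nat) (R : seq (word n)) (s s' t t' : word n) :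
  presents_eq R s s' -> presents_eq R t t' ->
  presents_eq R (s ++ t) (s' ++ t').
Proof.
move=> hs ht; apply: presents_trans (presents_cat [::] t hs) _.
by have := presents_cat s' [::] ht; rewrite !cats0.
Qed.

Lemma presents_inv (n : nat) (R : seq (word n)) (s t : word n) :
  presents_eq R s t -> presents_eq R (word_inv s) (word_inv t).
Proof.
move=> st; have := presents_cat (word_inv s) (word_inv t) st.
rewrite catA => h; apply: presents_sym.
have h1 := presents_cat [::] (word_inv t) (presents_inv_l R s).
have h2 := presents_cat (word_inv s) [::] (presents_inv_r R t).
move: h1 h2; rewrite /= !cats0 => h1 h2.
apply: presents_trans (presents_sym h1) _.
exact: presents_trans h h2.
Qed.

Definition presented_one (n : nat) (R : seq (word n)) : presented R :=
  \pi_(presented R) ([::] : word n).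

Definition presented_mul (n : nat) (R : seq (word n)) (a b : presented R) :
    presented R :=
  \pi_(presented R) (repr a ++ repr b : word n).

Definition presented_inv (n : nat) (R : seq (word n)) (a : presented R) :
    presented R :=
  \pi_(presented R) (word_inv (repr a)).

Lemma presentedP (n : nat) (R : seq (word n)) (s t : word n) :
  presents_eq R s t <-> \pi_(presented R) s = \pi t.
Proof.
split; first by move=> h; apply/eqquotP; apply/asboolP.
by move=> /eqquotP /asboolP.
Qed.

Lemma presents_repr (n : nat) (R : seq (word n)) (s : word n) :
  presents_eq R (repr (\pi_(presented R) s)) s.
Proof. by apply/presentedP; rewrite reprK. Qed.

Lemma presented_mulE (n : nat) (R : seq (word n)) (s t : word n) :
  presented_mul (\pi s) (\pi t) = \pi_(presented R) (s ++ t : word n).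
Proof. by apply/presentedP; apply: presents_mul; apply: presents_repr. Qed.

Lemma presented_invE (n : nat) (R : seq (word n)) (s : word n) :
  presented_inv (\pi s) = \pi_(presented R) (word_inv s).
Proof. by apply/presentedP; apply: presents_inv; apply: presents_repr. Qed.

Lemma presented_mulA (n : nat) (R : seq (word n)) :
  associative (@presented_mul n R).
Proof.
by elim/quotW=> s; elim/quotW=> t; elim/quotW=> u; rewrite !presented_mulE catA.
Qed.

Lemma presented_mul1g (n : nat) (R : seq (word n)) :
  left_id (presented_one R) (@presented_mul n R).
Proof. by elim/quotW=> s; rewrite presented_mulE. Qed.

Lemma presented_mulg1 (n : nat) (R : seq (word n)) :
  right_id (presented_one R) (@presented_mul n R).
Proof. by elim/quotW=> s; rewrite presented_mulE cats0. Qed.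

Lemma presented_mulVg (n : nat) (R : seq (word n)) :
  left_inverse (presented_one R) (@presented_inv n R) (@presented_mul n R).
Proof.
elim/quotW=> s; rewrite presented_invE presented_mulE.
by apply/presentedP; apply: presents_inv_l.
Qed.

Lemma presented_mulgV (n : nat) (R : seq (word n)) :
  right_inverse (presented_one R) (@presented_inv n R) (@presented_mul n R).
Proof.
elim/quotW=> s; rewrite presented_invE presented_mulE.
by apply/presentedP; apply: presents_inv_r.
Qed.

HB.instance Definition _ (n : nat) (R : seq (word n)) :=
  isGroup.Build (presented R) (@presented_mulA n R) (@presented_mul1g n R)
    (@presented_mulg1 n R) (@presented_mulVg n R) (@presented_mulgV n R).

Definition group_isomorphic (G H : groupType) : Prop :=
  exists f : {multiplicative G -> H}, bijective f.

Definition finitely_presented (G : groupType) : Prop :=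
  exists (n : nat) (R : seq (word n)), group_isomorphic (presented R) G.

(* Main.v *)
From HB Require Import structures.
Require Import Defs.
From mathcomp Require Import all_boot finmap all_classical zify.

(** The proof is a tower argument.

   The condition SD_2^*(k) asks for a vertex dominating a wheel with a pendant
   triangle, which a subcomplex may have lost.  When it holds in a finite
   complex and in all of its links, however, the dominating vertex may be taken
   to be the hub of the wheel: otherwise a dominating vertex lies outside of
   the configuration, the link of this vertex contains the same configuration,
   hence another dominating vertex, and so on, which produces simplices of
   every dimension (hub_condition_of_links).  The resulting condition, that the
   tip of the triangle be adjacent to the hub, only concerns balls of radius
   one, so that it pulls back along every map embedding these balls as full
   subcomplexes (hub_condition_pullback).  Inclusions of full subcomplexes,
   inclusions of links and coverings are such maps; the case of links shows
   that the hub condition gives back SD_2^*(k) links.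

   Now let H be presented by finitely many generators and relators.  Choose
   edge loops for the generators, and for each relator a finite chain of
   elementary homotopies contracting it in X; that only their consequences contract
   expresses that H embeds in the fundamental group.  These finite data (carries)
   play the role of a map to X from a compact complex with fundamental group H.
   They restrict to the full subcomplex Z on the vertices that they visit, and
   they lift to the cover C of Z whose group is generated by the chosen loops
   (carries_cover).  If some loop of Z is not homotopic to a product of the
   chosen loops, then C is a proper cover, in which two visits of a same vertex
   get separated or two visited vertices stop being adjacent: as Z is flag and
   has no further vertices, nothing else can distinguish the part of C spanned
   by the lifted data from Z.  The number of pairs of visits that are equal or
   adjacent thus decreases (complexity_map), and the argument is repeated with
   C in place of X.  When it stops decreasing, the fundamental group of Z is
   generated by the chosen loops, so it is H, and Z is a finite connected
   complex satisfying the hub condition (carries_reduce). *)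

Set Implicit Arguments.
Unset Strict Implicit.
Unset Printing Implicit Defensive.

Local Open Scope fset_scope.
Local Open Scope quotient_scope.

(** * Flag complexes and their edges *)

Lemma in_pair (V : choiceType) (a b u : V) :
  u \in [fset a; b] -> u = a \/ u = b.
Proof. by rewrite !inE => /orP[]/eqP->; [left|right]. Qed.

Lemma in_triple (V : choiceType) (a b c u : V) :
  u \in [fset a; b; c] -> [\/ u = a, u = b | u = c].
Proof.
by rewrite !inE -orbA => /or3P[]/eqP->; [constructor 1|constructor 2|constructor 3].
Qed.

Section Edges.
Variables (V : choiceType) (X : complex V).

Lemma edgeE a b : edge X a b <-> face X [fset a; b].
Proof. by split=> /asboolP. Qed.

Lemma edge_refl a : edge X a a <-> vertex X a.
Proof. by rewrite edgeE /vertex fsetUid. Qed.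

Lemma face_vertex s a : face X s -> a \in s -> vertex X a.
Proof.
move=> fs sa; apply: (face_sub fs); first by rewrite fsub1set.
by apply/fset0Pn; exists a; rewrite !inE.
Qed.

Lemma face_edge s a b : face X s -> a \in s -> b \in s -> edge X a b.
Proof.
move=> fs sa sb; apply/edgeE; apply: (face_sub fs).
  by rewrite fsubUset !fsub1set sa sb.
by apply/fset0Pn; exists a; rewrite !inE eqxx.
Qed.

Lemma edge_vertexl a b : edge X a b -> vertex X a.
Proof. by move=> /edgeE /face_vertex; apply; rewrite !inE eqxx. Qed.

Lemma edge_vertexr a b : edge X a b -> vertex X b.
Proof. by rewrite edgeC => /edge_vertexl. Qed.

Lemma adjE a b : adj X a b <-> a != b /\ edge X a b.
Proof. by rewrite /adj edgeE. Qed.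

Lemma adj_edge a b : adj X a b -> edge X a b.
Proof. by case/adjE. Qed.

Lemma adj_sym a b : adj X a b -> adj X b a.
Proof. by move=> /adjE[ab e]; apply/adjE; rewrite eq_sym edgeC. Qed.

(** A flag complex is the clique complex of its reflexive edge relation, so
   that everything below is a statement about that relation alone. *)
Lemma flag_face s : flag X ->
  s != fset0 -> (forall a b, a \in s -> b \in s -> edge X a b) -> face X s.
Proof.
move=> fX s0 e; apply: fX => // [v sv|u v su sv uv].
  by apply/edge_refl; apply: e.
by apply/adjE; split=> //; apply: e.
Qed.

Lemma flag_face3 a b c : flag X ->
  edge X a b -> edge X a c -> edge X b c -> face X [fset a; b; c].
Proof.
move=> fX ab ac bc; apply: flag_face => //.
  by apply/fset0Pn; exists a; rewrite !inE eqxx.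
have /edge_refl aa := edge_vertexl ab.
have /edge_refl bb := edge_vertexr ab.
have /edge_refl cc := edge_vertexr ac.
by move=> u v /in_triple[]-> /in_triple[]-> //; rewrite edgeC.
Qed.

End Edges.

Section CliqueComplex.
Variables (V : choiceType) (e : V -> V -> Prop).
Hypothesis esym : forall a b, e a b -> e b a.
Hypothesis erefl : forall a b, e a b -> e a a.

Definition clique (s : {fset V}) : Prop :=
  s != fset0 /\ forall a b, a \in s -> b \in s -> e a b.

Lemma clique_neq0 s : clique s -> s != fset0. Proof. by case. Qed.

Lemma clique_sub s t : clique s -> t `<=` s -> t != fset0 -> clique t.
Proof.
by move=> [_ es] /fsubsetP ts t0; split=> // a b /ts sa /ts sb; apply: es.
Qed.

Definition clique_complex : complex V := Complex clique_neq0 clique_sub.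

Lemma edge_clique a b : edge clique_complex a b <-> e a b.
Proof.
rewrite edgeE; split=> [[_]|ab]; first by apply; rewrite !inE eqxx ?orbT.
split; first by apply/fset0Pn; exists a; rewrite !inE eqxx.
have ba := esym ab; have aa := erefl ab; have bb := erefl ba.
by move=> u v /in_pair[]-> /in_pair[]->.
Qed.

Lemma clique_flag : flag clique_complex.
Proof.
move=> s s0 vs es; split=> // a b sa sb; apply/edge_clique.
have [<-|ab] := eqVneq a b; first by apply/edge_refl; apply: vs.
by apply: adj_edge; apply: es.
Qed.

End CliqueComplex.

Lemma edge_full (V : choiceType) (X : complex V) (A : V -> Prop) a b :
  edge (full_subcomplex X A) a b <-> [/\ edge X a b, A a & A b].
Proof.
rewrite edgeE /=; split=> [[/edgeE f AA]|[/edgeE f Aa Ab]].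
  by split=> //; apply: AA; rewrite !inE eqxx ?orbT.
by split=> // v /in_pair[]->.
Qed.

Lemma full_flag (V : choiceType) (X : complex V) (A : V -> Prop) :
  flag X -> flag (full_subcomplex X A).
Proof.
move=> fX s s0 vs es; split.
  apply: fX => // [v /vs[]//|u v su sv uv].
  by have [? []] := es u v su sv uv.
by move=> v /vs[_]; apply; rewrite inE.
Qed.

Lemma edge_link (V : choiceType) (X : complex V) (s : {fset V}) a b :
  edge (link X s) a b <->
  [/\ a \notin s, b \notin s & face X ([fset a; b] `|` s)].
Proof.
rewrite edgeE; split=> [[_ d f]|[sa sb f]].
  by split=> //; apply: (fdisjointP d); rewrite !inE eqxx ?orbT.
split=> //; first by apply/fset0Pn; exists a; rewrite !inE eqxx.
by apply/fdisjointP=> c; rewrite !inE => /orP[]/eqP->.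
Qed.

Lemma link_edge (V : choiceType) (X : complex V) (s : {fset V}) a b :
  edge (link X s) a b -> edge X a b.
Proof.
by move=> /edge_link[_ _ f]; apply: (face_edge f); rewrite !inE eqxx ?orbT.
Qed.

(** A clique is a simplex of the link as soon as its vertices are adjacent to
   every vertex of the base simplex. *)
Lemma flag_edge_link (V : choiceType) (X : complex V) (s : {fset V}) a b :
  flag X -> face X s ->
  (forall c, c \in s -> adj X c a /\ adj X c b) ->
  edge X a b -> edge (link X s) a b.
Proof.
move=> fX fs sab ab; apply/edge_link; split.
- by apply/negP=> /sab[[/eqP]].
- by apply/negP=> /sab[_ [/eqP]].
apply: flag_face => //; first by apply/fset0Pn; exists a; rewrite !inE eqxx.
have aa : edge X a a by apply/edge_refl; apply: edge_vertexl ab.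
have bb : edge X b b by apply/edge_refl; apply: edge_vertexr ab.
have sca c : c \in s -> edge X c a by case/sab => /adj_edge.
have scb c : c \in s -> edge X c b by case/sab => _ /adj_edge.
have join u : u \in [fset a; b] `|` s -> [\/ u = a, u = b | u \in s].
  move=> /fsetUP[/in_pair[]->|us]; by [constructor 1|constructor 2|constructor 3].
move=> u v /join[->|->|us] /join[->|->|vs] //; last exact: face_edge us vs.
- by rewrite edgeC; apply: sca.
- by rewrite edgeC.
- by rewrite edgeC; apply: scb.
- exact: sca.
- exact: scb.
Qed.

Lemma link_flag (V : choiceType) (X : complex V) (s : {fset V}) :
  flag X -> face X s -> flag (link X s).
Proof.
move=> fX fs t t0 vt et; split=> //.
  apply/fdisjointP=> a /vt[_ /fdisjointP + _]; apply; exact: fset11.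
apply: flag_face => //.
  by case/fset0Pn: t0 => a ta; apply/fset0Pn; exists a; rewrite !inE ta.
have ets a b : a \in t -> b \in s -> edge X a b.
  move=> /vt[_ _ f] sb; apply: (face_edge f); first by rewrite !inE eqxx.
  by rewrite !inE sb orbT.
move=> u v /fsetUP[ut|us] /fsetUP[vt'|vs].
- have [<-|uv] := eqVneq u v.
    case: (vt u ut) => _ _ f; apply: (face_edge f); by rewrite !inE eqxx.
  have /adj_edge/edge_link[_ _ f] := et u v ut vt' uv.
  by apply: (face_edge f); rewrite !inE eqxx ?orbT.
- exact: ets.
- by rewrite edgeC; apply: ets.
- exact: face_edge us vs.
Qed.

(** * The wheel condition in local form *)

(** The tip of every pendant triangle is adjacent to the hub of its wheel.
   Unlike the existence of a dominating vertex somewhere in the complex, this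
   only involves the vertices of the configuration, which is why it passes to
   full subcomplexes and to covers. *)
Definition hub_condition (k : nat) (V : choiceType) (X : complex V) : Prop :=
  [/\ flag X,
      (forall v, ~ is_wheel X 4 v) &
      (forall l v t, 5 <= l < k -> is_wheel X l v -> is_pendant X l v t ->
         adj X (v 0) t)].

Section Wheels.
Variables (V : choiceType) (X : complex V).

Lemma pendant_adj l v t : 2 <= l -> is_pendant X l v t ->
  adj X (v 1) t /\ adj X (v 2) t.
Proof.
move=> l2 [tv f]; split; apply/adjE; split.
- by apply/negP=> /eqP e; apply: (tv 1) => //; apply: ltnW.
- by apply: (face_edge f); rewrite !inE eqxx ?orbT.
- by apply/negP=> /eqP e; apply: (tv 2).
- by apply: (face_edge f); rewrite !inE eqxx ?orbT.
Qed.

Lemma pendant_vertex l v t (A : V -> Prop) : is_wheel X l v -> 2 <= l ->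
  is_pendant X l v t ->
  (forall s, face (pendant_wheel X l v t) s -> forall a, a \in s -> A a) ->
  A t /\ forall i, i <= l -> A (v i).
Proof.
move=> [_ w] l2 [_ ft] hA; split.
  apply: (hA [fset v 1; v 2; t]); last by rewrite !inE eqxx orbT.
  right; split=> //; exact: face_neq0 ft.
move=> i il; apply: (hA [fset v i]); last exact: fset11.
left; split; last by move=> u; rewrite inE => /eqP->; exists i.
case: i il => [|i] il.
  have l1 : 1 <= 1 <= l by lia.
  exact: edge_vertexl (adj_edge (w 1 l1)).
exact: edge_vertexr (adj_edge (w i.+1 il)).
Qed.

(** A vertex whose ball contains a wheel with a pendant triangle is either the
   hub, or the tip, or adjacent to all of the configuration: no rim vertex
   dominates the rim, which has at least five vertices. *)
Lemma dominating_vertex k l v t : SD2star k X -> 5 <= l < k ->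
  is_wheel X l v -> is_pendant X l v t ->
  adj X (v 0) t \/
  exists u, adj X u t /\ forall i, i <= l -> adj X u (v i).
Proof.
move=> [_ _ sd] lk w pt; have /andP[l5 _] := lk.
have l2 : 2 <= l by apply: leq_trans l5.
have [u _ sub] := sd l v t lk w pt.
have [ut uv] := @pendant_vertex l v t (fun a => a = u \/ adj X u a) w l2 pt
  (fun s fs => (proj2 (sub s fs))).
case: ut => [ut|ut].
  left; case: (uv 0) => // [e|]; first by case: pt => /(_ 0 isT); rewrite ut e.
  by rewrite -ut => /adj_sym.
have [[i il ui]|ui] := pselect (exists2 i, i <= l & u = v i).
  case: i il ui => [|i] il ui; first by left; rewrite -ui.
  exfalso; have [c _] := w.
  have no j : 1 <= j <= l -> i.+1 != j ->
      [\/ j = i.+2, i.+1 = j.+1, i.+1 = 1 /\ j = l | i.+1 = l /\ j = 1].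
    move=> jl ij; have [inj [+ _]] := c i.+1 j il jl; apply.
    case/andP: (jl) => _ /uv[e|]; last by rewrite ui.
    by case/eqP: ij; apply: inj; rewrite e ui.
  have : exists2 j, 1 <= j <= l & [&& i.+1 != j, j != i.+2, i.+1 != j.+1,
      ~~ ((i.+1 == 1) && (j == l)) & ~~ ((i.+1 == l) && (j == 1))].
    (* Two steps away from i.+1 along the rim, in a direction that does not
       wrap around. *)
    by exists (if i <= 1 then i.+3 else i.-1); case: (leqP i 1) => ?; lia.
  case=> j jl /and5P[n1 n2 n3 n4 n5]; case: (no j jl n1) => [e|e|[e e']|[e e']].
  - by rewrite e eqxx in n2.
  - by rewrite e eqxx in n3.
  - by rewrite e e' !eqxx in n4.
  - by rewrite e e' !eqxx in n5.
right; exists u; split=> // i il; case: (uv i il) => // e.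
by case: ui; exists i.
Qed.

End Wheels.

Lemma link_wheel (V : choiceType) (X : complex V) (s : {fset V}) l v t :
  flag X -> face X s -> 2 <= l -> is_wheel X l v -> is_pendant X l v t ->
  (forall u, u \in s -> adj X u t /\ forall i, i <= l -> adj X u (v i)) ->
  is_wheel (link X s) l v /\ is_pendant (link X s) l v t.
Proof.
move=> fX fs l2 w pt sv; have [c w0] := w.
have adjL i j : i <= l -> j <= l ->
    adj (link X s) (v i) (v j) <-> adj X (v i) (v j).
  move=> il jl; rewrite !adjE; split=> [[ne /link_edge]//|[ne e]]; split=> //.
  by apply: flag_edge_link => // u /sv[_ us]; split; apply: us.
have [v1t v2t] := pendant_adj l2 pt.
split; split.
- move=> i j il jl; have [inj cyc] := c i j il jl; split=> //.
  by rewrite adjL ?(andP il).2 ?(andP jl).2.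
- by move=> i il; apply/adjL => //; [case/andP: il | apply: w0].
- by case: pt.
apply: flag_face3; first exact: link_flag.
- apply: (adj_edge (proj2 (adjL 1 2 _ _) _)) => //; first exact: ltnW.
  have l1 : 1 <= 1 <= l by lia.
  have l2' : 1 <= 2 <= l by [].
  by apply/(proj2 (c 1 2 l1 l2')); constructor 1.
- apply: flag_edge_link (adj_edge v1t) => // u /sv[ut us].
  by split=> //; apply: us; apply: ltnW.
- by apply: flag_edge_link (adj_edge v2t) => // u /sv[ut us]; split=> //; apply: us.
Qed.

(** If the tip were not adjacent to the hub, a dominating vertex outside of the
   configuration would exist, then a second one in the link of the first, and
   so on: these vertices would span simplices of arbitrarily large dimension. *)
Lemma hub_condition_of_links k (V : choiceType) (X : complex V) :
  finite_complex X -> SD2star_links k X -> hub_condition k X.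
Proof.
move=> fin [sdX sdL]; have [fX no4 _] := sdX; split=> // l v t lk w pt.
apply: contrapT => ntv; have /andP[l5 _] := lk.
have l2 : 2 <= l by apply: leq_trans l5.
have big n : exists s, [/\ face X s, n < #|` s| &
    forall u, u \in s -> adj X u t /\ forall i, i <= l -> adj X u (v i)].
  elim: n => [|n [s [fs ns sv]]].
    have [//|[u [ut uv]]] := dominating_vertex sdX lk w pt.
    exists [fset u]; split; last by move=> a /fset1P ->.
      exact: edge_vertexl (adj_edge ut).
    by rewrite cardfs1.
  have [wL ptL] := link_wheel fX fs l2 w pt sv.
  have sub a b : adj (link X s) a b -> adj X a b.
    by move=> /adjE[ab /link_edge e]; apply/adjE.
  have [/sub//|[u [ut uv]]] := dominating_vertex (sdL s fs) lk wL ptL.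
  have [_ du fu] := edge_vertexl (adj_edge ut).
  exists (u |` s); split=> //.
    by rewrite cardfsU1 (fdisjointP du) ?fset11.
  move=> a /fset1UP[->|/sv//]; split; first exact: sub.
  by move=> i il; apply/sub/uv.
have /finite_fsetP[A AX] := fin.
have [s [fs ns _]] := big (\max_(B <- A) #|` B|).
have sA : s \in A by have : [set` A]%classic s by rewrite -AX.
have := leq_bigmax_seq (F := fun B : {fset V} => #|` B|) _ sA isT.
by rewrite leqNgt ns.
Qed.

(** * Locally injective, locally full maps *)

(** What inclusions of full subcomplexes, inclusions of links and covering maps
   have in common: the map embeds every ball of radius one as a full
   subcomplex of its image. *)
Definition locally_full (V W : choiceType) (X : complex V) (Y : complex W)
    (f : V -> W) : Prop :=
  [/\ (forall a b, edge X a b -> edge Y (f a) (f b)),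
      (forall a b c, edge X a b -> edge X a c -> f b = f c -> b = c) &
      (forall a b c, edge X a b -> edge X a c -> edge Y (f b) (f c) ->
        edge X b c)].

(** A wheel with a pendant triangle lies in the union of the balls about its
   hub and about the first rim vertex, so its image is again one: the only
   identification not excluded within a single ball, that of the tip with a rim
   vertex, would make this rim vertex a neighbour of the first one. *)
Lemma hub_condition_pullback k (V W : choiceType) (X : complex V)
    (Y : complex W) (f : V -> W) :
  flag X -> locally_full X Y f -> hub_condition k Y -> hub_condition k X.
Proof.
move=> fX [fE finj ffull] [fY no4 hub].
have fadj a b : adj X a b -> adj Y (f a) (f b).
  move=> /adjE[ab e]; apply/adjE; split; last exact: fE.
  apply: contra ab => /eqP fab; apply/eqP; apply: (finj a) fab => //.
  exact/edge_refl/(edge_vertexl e).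
have fadjK : forall a b c,
    edge X a b -> edge X a c -> adj Y (f b) (f c) -> adj X b c.
  move=> a b c ab ac /adjE[ne e]; apply/adjE; split; last exact: ffull ab ac e.
  by apply: contra ne => /eqP->.
have fw l v : is_wheel X l v -> is_wheel Y l (f \o v).
  move=> [c w]; split=> [i j il jl|i /w]; last exact: fadj.
  have [inj cyc] := c i j il jl.
  have vi := adj_edge (w i il); have vj := adj_edge (w j jl).
  split=> [/(finj _ _ _ vi vj)//|]; rewrite -cyc /=.
  by split; [apply: fadjK vi vj | apply: fadj].
split=> // [v /fw|l v t lk w pt]; first exact: no4.
have l2 : 2 <= l by lia.
have l1 : 1 <= 1 <= l by lia.
have [v1t v2t] := pendant_adj l2 pt; have [tv _] := pt.
have [c w0] := w; have e1 := w0 1 l1.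
suff [e0|e0] : adj Y (f (v 0)) (f t) \/ f (v 0) = f t.
- exact: fadjK (adj_edge (adj_sym e1)) (adj_edge v1t) e0.
- case: (tv 0) => //; apply: esym.
  exact: finj (adj_edge (adj_sym e1)) (adj_edge v1t) e0.
left; apply: (hub l _ _ lk (fw l v w)); split; last first.
  apply: flag_face3 => //.
  - apply/fE/adj_edge; have l2' : 1 <= 2 <= l by [].
    by apply/(proj2 (c 1 2 l1 l2')); constructor 1.
  - exact/fE/adj_edge.
  - exact/fE/adj_edge.
case=> [|i] il /= e.
  by apply: (tv 0) => //; apply: finj (adj_edge v1t) (adj_edge (adj_sym e1)) e.
have il' : 1 <= i.+1 <= l by [].
have e1i : adj X (v 1) (v i.+1).
  apply: (fadjK _ _ _ (adj_edge e1) (adj_edge (w0 _ il'))).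
  by rewrite -e; apply: fadj.
by apply: (tv i.+1) => //; apply: finj (adj_edge v1t) (adj_edge e1i) e.
Qed.

Lemma locally_full_link (V : choiceType) (X : complex V) (s : {fset V}) :
  flag X -> face X s -> locally_full (link X s) X id.
Proof.
move=> fX fs.
have ladj a b : edge (link X s) a b -> forall c, c \in s -> adj X c b.
  move=> /edge_link[_ bs f] c cs; apply/adjE; split.
    by apply: contraNneq bs => <-.
  by apply: (face_edge f); rewrite !inE ?cs ?eqxx ?orbT.
split=> [a b /link_edge //|//|a b c ab ac bc].
apply: flag_edge_link => // u us.
by split; [apply: ladj ab _ us | apply: ladj ac _ us].
Qed.

Lemma SD2star_of_hub_condition k (V : choiceType) (X : complex V) :
  hub_condition k X -> SD2star k X.
Proof.
move=> [fX no4 hub]; split=> // l v t lk w pt.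
have v0t := hub l v t lk w pt.
exists (v 0); first exact: edge_vertexl (adj_edge v0t).
have ball i : i <= l -> v i = v 0 \/ adj X (v 0) (v i).
  by case: i => [|i] il; [left | right; apply: (proj2 w)].
move=> s [[fs sv]|[s0 /fsubsetP st]]; split=> //.
- by move=> a /sv[i il ->]; apply: ball.
- apply: (face_sub (proj2 pt)) => //; exact/fsubsetP.
by move=> a /st /in_triple[]->; [apply: ball; lia | apply: ball; lia | right].
Qed.

Lemma SD2star_links_of_hub_condition k (V : choiceType) (X : complex V) :
  hub_condition k X -> SD2star_links k X.
Proof.
move=> hX; have [fX _ _] := hX.
split=> [|s fs]; apply: SD2star_of_hub_condition => //.
apply: hub_condition_pullback hX; first exact: link_flag.
exact: locally_full_link.
Qed.

Lemma locally_full_full (V : choiceType) (X : complex V) (A : V -> Prop) :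
  locally_full (full_subcomplex X A) X id.
Proof.
by split=> [a b /edge_full[]|//|a b c /edge_full[_ _ Ab] /edge_full[_ _ Ac] e];
  rewrite ?edge_full.
Qed.

(** * Edge paths and words in loops *)

Lemma homotopic_map (V W : choiceType) (X : complex V) (Y : complex W)
    (f : V -> W) s t :
  (forall a b c, face X [fset a; b; c] -> face Y [fset f a; f b; f c]) ->
  homotopic X s t -> homotopic Y (map f s) (map f t).
Proof.
move=> fXY; elim=> [{}s|{}s {}t _|{}s {}t r _ + _|p a q|p a b c q abc].
- exact: homotopic_refl.
- exact: homotopic_sym.
- exact: homotopic_trans.
- by rewrite !map_cat /=; apply: homotopic_repeat.
- by rewrite !map_cat /=; apply/homotopic_triangle/fXY.
Qed.

Lemma locally_full_face3 (V W : choiceType) (X : complex V) (Y : complex W)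
    (f : V -> W) a b c :
  locally_full X Y f -> flag Y ->
  face X [fset a; b; c] -> face Y [fset f a; f b; f c].
Proof.
move=> [fE _ _] fY abc.
by apply: flag_face3 => //; apply: fE; apply: (face_edge abc);
  rewrite !inE eqxx ?orbT.
Qed.

Lemma homotopic_last (V : choiceType) (X : complex V) s t a :
  homotopic X s t -> last a s = last a t.
Proof.
by elim=> {s t} [s|s t _ ->|s t r _ -> _ ->|p b q|p b c d q _] //;
  rewrite !last_cat.
Qed.

(** A homotopy may be performed in the middle of an edge path that comes back
   to the base point. *)
Lemma homotopic_insert (V : choiceType) (X : complex V) x u s t w :
  last x u = x -> homotopic X (x :: s) (x :: t) ->
  homotopic X (x :: u ++ s ++ w) (x :: u ++ t ++ w).
Proof.
move=> ux st; rewrite -!cat_cons [x :: u]lastI ux !cat_rcons -!cat_cons.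
exact: homotopic_cat.
Qed.

Section WordPath.
Variables (V : choiceType) (x : V) (n : nat) (q : 'I_n -> seq V).

Definition letter_path (a : 'I_n * bool) : seq V :=
  if a.2 then rev (belast x (q a.1)) else q a.1.

Definition word_path (w : word n) : seq V := flatten (map letter_path w).

Lemma word_path_cat v w : word_path (v ++ w) = word_path v ++ word_path w.
Proof. by rewrite /word_path map_cat flatten_cat. Qed.

Lemma word_path_sub a w : a \in word_path w ->
  a = x \/ exists i, a \in q i.
Proof.
move=> /flattenP[s /mapP[[i b] _ ->]]; rewrite /letter_path /=.
case: b => [|ai]; last by right; exists i.
rewrite mem_rev => /mem_belast; rewrite inE => /predU1P[->|ai]; first by left.
by right; exists i.
Qed.

Variable X : complex V.
Hypothesis ql : forall i, is_loop X x (q i).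

Lemma letter_path_loop a : is_loop X x (letter_path a).
Proof.
case: a => i [] /=; rewrite /letter_path /=; last exact: ql.
exact: is_loop_rev (ql i).
Qed.

Lemma word_path_loop w : is_loop X x (word_path w).
Proof.
elim: w => [|a w IH]; first exact: is_loop_nil.
exact: is_loop_cat (letter_path_loop a) IH.
Qed.

Lemma word_path_last w : last x (word_path w) = x.
Proof. by case/andP: (word_path_loop w) => _ /eqP. Qed.

Lemma letter_path_inv a :
  letter_path (letter_inv a) = rev (belast x (letter_path a)).
Proof.
case: a => i [] //=; rewrite /letter_path /=.
by have /(congr1 val)/= := loop_invK (exist _ (q i) (ql i) : loop X x).
Qed.

Lemma rev_belast_cat p r : last x p = x ->
  rev (belast x (p ++ r)) = rev (belast x r) ++ rev (belast x p).
Proof. by move=> px; rewrite belast_cat px rev_cat. Qed.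

Lemma word_path_inv w : word_path (word_inv w) = rev (belast x (word_path w)).
Proof.
elim: w => [|a w IH] //.
rewrite /word_inv /= rev_cons -cats1 word_path_cat -/(word_inv w) IH.
rewrite /= [word_path (a :: w)]/= rev_belast_cat.
  by rewrite /word_path /= cats0 letter_path_inv.
by case/andP: (letter_path_loop a) => _ /eqP.
Qed.

Lemma homotopic_word_path (R : seq (word n)) v w :
  (forall r, r \in R -> homotopic X (x :: word_path r) [:: x]) ->
  presents_eq R v w -> homotopic X (x :: word_path v) (x :: word_path w).
Proof.
move=> hR; elim=> {v w} [v|v w _|v w u _ + _|u a v|u r v /hR hr].
- exact: homotopic_refl.
- exact: homotopic_sym.
- exact: homotopic_trans.
- rewrite !word_path_cat -[word_path v]cat0s.
  have -> : word_path (a :: letter_inv a :: v) =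
      (letter_path a ++ rev (belast x (letter_path a))) ++ word_path v.
    by rewrite -letter_path_inv -catA.
  apply: homotopic_insert (word_path_last u) _.
  by apply: homotopic_backtrack; case/andP: (letter_path_loop a).
- rewrite !word_path_cat -[word_path v in X in homotopic _ _ X]cat0s.
  exact: homotopic_insert (word_path_last u) hr.
Qed.

End WordPath.

Lemma map_belast (V W : Type) (f : V -> W) a s :
  map f (belast a s) = belast (f a) (map f s).
Proof. by elim: s a => //= b s IH a; rewrite IH. Qed.

Lemma map_word_path (V W : choiceType) (f : V -> W) x n (q : 'I_n -> seq V) w :
  map f (word_path x q w) = word_path (f x) (fun i => map f (q i)) w.
Proof.
rewrite /word_path map_flatten -map_comp; congr flatten; apply: eq_map.
by case=> i []; rewrite /letter_path //= map_rev map_belast.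
Qed.

(** * Elementary homotopies *)

Inductive move (V : choiceType) (X : complex V) : seq V -> seq V -> Prop :=
| move_repeat p a r : move X (p ++ a :: a :: r) (p ++ a :: r)
| move_triangle p a b c r : face X [fset a; b; c] ->
    move X (p ++ a :: b :: c :: r) (p ++ a :: c :: r).

Definition moves (V : choiceType) (X : complex V) : rel (seq V) :=
  fun s t => `[< move X s t \/ move X t s >].

Section Moves.
Variables (V : choiceType) (X : complex V).

Lemma moves_sym : symmetric (moves X).
Proof. by move=> s t; apply/asboolP/asboolP=> -[]; [right|left|right|left]. Qed.

(** Only a finite list of sequences is kept from a homotopy, so that it can be
   lifted and its points counted. *)
Lemma homotopic_chain s t : homotopic X s t ->
  exists2 c, path (moves X) s c & last s c = t.
Proof.
elim=> {s t} [s|s t _ [c pc <-]|s t r _ [c pc ct] _ [d pd dr]|p a q|p a b c q abc].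
- by exists [::].
- exists (rev (belast s c)).
    by rewrite rev_path (eq_path (e' := moves X)) // => u v; apply: moves_sym.
  by case: c pc => //= a c _; rewrite rev_cons last_rcons.
- by exists (c ++ d); rewrite ?cat_path ?last_cat ?pc ct.
- exists [:: p ++ a :: q] => //=; rewrite andbT; apply/asboolP; left.
  exact: move_repeat.
- exists [:: p ++ a :: c :: q] => //=; rewrite andbT; apply/asboolP; left.
  exact: move_triangle.
Qed.

Lemma chain_homotopic s c : path (moves X) s c -> homotopic X s (last s c).
Proof.
have mh u v : move X u v -> homotopic X u v.
  by case=> *; [apply: homotopic_repeat | apply: homotopic_triangle].
elim: c s => [|t c IH] s /=; first by move=> _; apply: homotopic_refl.
case/andP=> /asboolP st /IH; apply: homotopic_trans.
by case: st => /mh // /homotopic_sym.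
Qed.

(** Homotopies are generated by moves between arbitrary sequences.  Those that
   start from an edge path stay among edge paths, hence can be lifted, provided
   that one-point sequences are required to consist of a vertex: a point may be
   repeated only if it is adjacent to itself. *)
Definition edge_path (s : seq V) : Prop :=
  sorted (edge X) s /\ forall a, a \in s -> vertex X a.

Lemma sorted_mid p a r :
  sorted (edge X) (p ++ a :: r) = sorted (edge X) (rcons p a) && path (edge X) a r.
Proof. by case: p => //= b p; rewrite cat_path rcons_path /= andbA. Qed.

Lemma move_edge_path s t : move X s t -> edge_path s <-> edge_path t.
Proof.
case=> [p a r|p a b c r abc]; rewrite /edge_path !sorted_mid /=.
  split=> [[/and3P[-> _ ->] vs]|[/andP[-> ->] vs]]; split=> //.
  - by move=> d dr; apply: vs; move: dr; rewrite !mem_cat !inE; case: (_ == _);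
      rewrite ?orbT.
  - by rewrite andbT; apply/edge_refl/vs; rewrite mem_cat inE eqxx orbT.
  - by move=> d dr; apply: vs; move: dr; rewrite !mem_cat !inE; case: (_ == _);
      rewrite ?orbT.
have va d : d \in [fset a; b; c] -> vertex X d by apply: face_vertex.
have ab : edge X a b by apply: (face_edge abc); rewrite !inE eqxx ?orbT.
have ac : edge X a c by apply: (face_edge abc); rewrite !inE eqxx ?orbT.
have bc : edge X b c by apply: (face_edge abc); rewrite !inE eqxx ?orbT.
rewrite ab ac bc /=; split=> [[-> vs]|[-> vs]]; split=> // d dr.
  by apply: vs; move: dr; rewrite !mem_cat !inE => /or3P[->|->|->] //;
    rewrite ?orbT.
have [->|db] := eqVneq d b; first by apply: va; rewrite !inE eqxx orbT.
by apply: vs; move: dr; rewrite !mem_cat !inE (negbTE db).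
Qed.

Lemma move_head s t a : move X s t -> head a s = head a t.
Proof. by case=> [] [|b p] *. Qed.

Lemma move_nil s t : move X s t -> (s != [::]) && (t != [::]).
Proof. by case=> [] [|b p] *. Qed.

Lemma moves_base x p t : vertex X x -> path (edge X) x p ->
  moves X (x :: p) t -> exists2 p', t = x :: p' & path (edge X) x p'.
Proof.
move=> vx xp m; have ep : edge_path (x :: p).
  split=> // a; rewrite inE => /predU1P[->//|ap].
  elim: p x xp ap {vx m} => //= b p IH x /andP[xb bp]; rewrite inE.
  by case/predU1P=> [->|/(IH b bp)//]; apply: edge_vertexr xb.
have [et h t0] : [/\ edge_path t, head x t = x & t != [::]].
  by case/asboolP: m => m; split; first [by apply/(move_edge_path m)
    | by rewrite ?(move_head x m) // -(move_head x m)
    | by case/andP: (move_nil m)].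
by case: t et h t0 {m} => //= b p' [bp' _] e _; exists p'; rewrite -?e.
Qed.

(** All sequences of a homotopy that starts from an edge path are edge paths
   with the same origin. *)
Lemma chain_base x p c : vertex X x -> path (edge X) x p ->
  path (moves X) (x :: p) c ->
  forall t, t \in c -> exists2 p', t = x :: p' & path (edge X) x p'.
Proof.
move=> vx; elim: c p => //= s c IH p xp /andP[/(moves_base vx xp)[p' -> xp'] pc].
by move=> t; rewrite inE => /predU1P[->|]; [exists p' | apply: IH xp' pc t].
Qed.

End Moves.

(** * The cover of a flag complex attached to a group of loops *)

Section Cover.
Variables (V : choiceType) (X : complex V) (x : V) (G : seq V -> Prop).
Hypotheses (flagX : flag X) (vx : vertex X x).
Hypotheses (G1 : G [::]) (GM : forall g h, G g -> G h -> G (g ++ h)).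
Hypotheses (GV : forall g, G g -> G (rev (belast x g))).
Hypothesis Gl : forall g, G g -> is_loop X x g.

(** The sequences need not be edge paths: this makes the relation an
   equivalence on the whole type, and only edge paths will define vertices. *)
Definition same_coset (p r : seq V) : Prop :=
  exists2 g, G g & homotopic X (x :: p) (x :: g ++ r).

Lemma G_last g : G g -> last x g = x.
Proof. by move=> /Gl/andP[_ /eqP]. Qed.

Lemma same_coset_hom p r :
  homotopic X (x :: p) (x :: r) -> same_coset p r.
Proof. by exists [::]. Qed.

Lemma same_coset_refl p : same_coset p p.
Proof. exact/same_coset_hom/homotopic_refl. Qed.

Lemma same_coset_sym p r : same_coset p r -> same_coset r p.
Proof.
case=> g Gg h; exists (rev (belast x g)); first exact: GV.
have Gg' := GV Gg; apply: homotopic_sym.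
have := homotopic_insert [::] (G_last Gg') h; rewrite !cats0 => h'.
apply: homotopic_trans h' _; rewrite catA.
apply: (homotopic_insert (u := [::]) (t := [::])) => //.
have := homotopic_backtrack (proj1 (andP (Gl Gg'))).
by have /(congr1 val)/= -> := loop_invK (exist _ g (Gl Gg) : loop X x).
Qed.

Lemma same_coset_trans p r s :
  same_coset p r -> same_coset r s -> same_coset p s.
Proof.
case=> g Gg gh [g' Gg' gh']; exists (g ++ g'); first exact: GM.
apply: homotopic_trans gh _.
by have := homotopic_insert [::] (G_last Gg) gh'; rewrite !cats0 catA.
Qed.

Lemma same_coset_rcons p r a :
  same_coset p r -> same_coset (rcons p a) (rcons r a).
Proof.
case=> g Gg /(homotopic_cat [::] [:: a]); rewrite /= -catA !cats1.
by exists g.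
Qed.

(** A vertex of the cover is a coset of edge paths issued from the base point,
   taken as a set of paths in order to be compared by equality. *)
Definition coset (p : seq V) : set (seq V) := [set r | same_coset p r]%classic.

Lemma cosetP p r : coset p = coset r <-> same_coset p r.
Proof.
split=> [e|pr].
  have : coset p r by rewrite e; apply: same_coset_refl.
  by [].
apply/seteqP; split=> s.
  by apply: same_coset_trans; apply: same_coset_sym.
exact: same_coset_trans.
Qed.

Lemma coset_hom p r : homotopic X (x :: p) (x :: r) -> coset p = coset r.
Proof. by move=> h; apply/cosetP/same_coset_hom. Qed.

Lemma coset_rcons p r a :
  coset p = coset r -> coset (rcons p a) = coset (rcons r a).
Proof. by move=> /cosetP pr; apply/cosetP/same_coset_rcons. Qed.

Lemma coset_repeat p : coset (rcons p (last x p)) = coset p.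
Proof.
apply: coset_hom.
have := homotopic_repeat X (belast x p) (last x p) [::].
by rewrite !cats1 -cat_rcons cats1 -lastI rcons_cons.
Qed.

Lemma coset_triangle p a b : face X [fset last x p; a; b] ->
  coset (rcons (rcons p a) b) = coset (rcons p b).
Proof.
move=> f; apply: coset_hom.
have := homotopic_triangle (belast x p) [::] f.
by rewrite -!cat_rcons -lastI !cats0 -!rcons_cons -!cats1 -!catA.
Qed.

(** All members of a coset have the same end point, and the choice of one of
   them is immaterial. *)
Definition cover_proj (c : set (seq V)) : V := last x (xget [::] c).

Lemma cover_projE p : cover_proj (coset p) = last x p.
Proof.
have : coset p (xget [::] (coset p)).
  by apply: xgetPex; exists p; apply: same_coset_refl.
case=> g Gg /homotopic_last -/(_ x) /=.
by rewrite last_cat (G_last Gg) => ->.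
Qed.

(** Adjacency or equality: the case where a is the end point of p gives a loop
   at the coset of p, by coset_repeat. *)
Definition cover_edge (c d : set (seq V)) : Prop :=
  exists p a, [/\ path (edge X) x (rcons p a), c = coset p
    & d = coset (rcons p a)].

Lemma cover_edge_sym c d : cover_edge c d -> cover_edge d c.
Proof.
move=> [p [a [xpa -> ->]]]; move: (xpa); rewrite rcons_path => /andP[xp pa].
exists (rcons p a), (last x p); split=> //.
  by rewrite rcons_path xpa last_rcons edgeC.
rewrite coset_triangle ?coset_repeat //; exact: face2.
Qed.

Lemma cover_edge_refl c d : cover_edge c d -> cover_edge c c.
Proof.
move=> [p [a [xpa -> _]]]; move: xpa; rewrite rcons_path => /andP[xp pa].
exists p, (last x p); rewrite coset_repeat rcons_path xp; split=> //.
exact/edge_refl/(edge_vertexl pa).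
Qed.

(** As the base is flag, so is the cover, and it may be defined by its edges
   alone. *)
Definition coset_cover : complex (set (seq V)) := clique_complex cover_edge.

Lemma edge_cover c d : edge coset_cover c d <-> cover_edge c d.
Proof. by apply: edge_clique; [apply: cover_edge_sym|apply: cover_edge_refl]. Qed.

Lemma flag_cover : flag coset_cover.
Proof. by apply: clique_flag; [apply: cover_edge_sym|apply: cover_edge_refl]. Qed.

Lemma vertex_cover : vertex coset_cover (coset [::]).
Proof.
apply/edge_refl/edge_cover; exists [::], x; split=> //=.
  by rewrite andbT; apply/edge_refl.
exact: esym (coset_repeat [::]).
Qed.

(** Neighbours of the same point of the cover extend one path by different
   vertices, so they are equal or adjacent exactly when these vertices are. *)
Lemma cover_locally_full : locally_full coset_cover X cover_proj.
Proof.
split=> [c d /edge_cover[p [a [xpa -> ->]]]|c d d' cd cd' e|c d d' cd cd' e].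
- by rewrite !cover_projE last_rcons; move: xpa; rewrite rcons_path => /andP[].
- move/edge_cover: cd e => [p [a [xpa cp ->]]].
  move/edge_cover: cd' => [p' [a' [_ + ->]]]; rewrite cp => pp'.
  by rewrite !cover_projE !last_rcons => ->; apply: coset_rcons.
move/edge_cover: cd e => [p [a [xpa cp ->]]].
move/edge_cover: cd' => [p' [a' [xpa' + ->]]]; rewrite cp => pp'.
rewrite !cover_projE !last_rcons => aa'; apply/edge_cover.
have pp'l : last x p = last x p' by rewrite -!cover_projE pp'.
rewrite -(coset_rcons a' pp').
exists (rcons p a), a'; split=> //.
  by rewrite rcons_path xpa last_rcons.
apply: esym (coset_triangle _); apply: flag_face3 => //.
  by move: xpa; rewrite rcons_path => /andP[].
by rewrite pp'l; move: xpa'; rewrite rcons_path => /andP[].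
Qed.

(** * Lifting paths and homotopies *)

Fixpoint lift_path (p r : seq V) : seq (set (seq V)) :=
  if r is a :: r' then coset (rcons p a) :: lift_path (rcons p a) r' else [::].

Lemma map_lift p r : map cover_proj (lift_path p r) = r.
Proof.
elim: r p => //= a r IH p.
by rewrite IH cover_projE last_rcons.
Qed.

Lemma last_lift p r : last (coset p) (lift_path p r) = coset (p ++ r).
Proof. by elim: r p => /= [|a r IH] p; rewrite ?cats0 // IH cat_rcons. Qed.

Lemma path_lift p r : path (edge X) x (p ++ r) ->
  path (edge coset_cover) (coset p) (lift_path p r).
Proof.
elim: r p => //= a r IH p; rewrite -cat_rcons => xpr.
rewrite IH // andbT; apply/edge_cover; exists p, a; split=> //.
by move: xpr; rewrite cat_path => /andP[].
Qed.

Lemma lift_coset p p' r : coset p = coset p' -> lift_path p r = lift_path p' r.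
Proof.
elim: r p p' => //= a r IH p p' pp'.
by rewrite (coset_rcons a pp'); congr (_ :: _); apply/IH/coset_rcons.
Qed.

Lemma lift_cat p r s : lift_path p (r ++ s) = lift_path p r ++ lift_path (p ++ r) s.
Proof.
by elim: r p => /= [|a r IH] p; rewrite ?cats0 // IH cat_rcons.
Qed.

(** This is what identifies, without computing them, the lifts of inverses and
   of products of loops. *)
Lemma lift_unique p P : path (edge X) x p ->
  path (edge coset_cover) (coset p) P -> P = lift_path p (map cover_proj P).
Proof.
elim: P p => //= c P IH p xp /andP[pc cP].
have [fE finj _] := cover_locally_full.
have xpc : path (edge X) x (rcons p (cover_proj c)).
  by rewrite rcons_path xp -cover_projE; apply: fE.
have e : c = coset (rcons p (cover_proj c)).
  apply: finj pc _ _; last by rewrite cover_projE last_rcons.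
  by apply/edge_cover; exists p, (cover_proj c).
by rewrite -e -IH // -e.
Qed.

Definition full_lift (s : seq V) : seq (set (seq V)) :=
  coset [::] :: lift_path [::] s.

Lemma full_liftE u r : full_lift (u ++ r) =
  belast (coset [::]) (lift_path [::] u) ++ coset u :: lift_path u r.
Proof. by rewrite /full_lift lift_cat -cat_cons lastI last_lift cat_rcons. Qed.

Lemma split_at (p s : seq V) a r : x :: p = s ++ a :: r ->
  exists2 u, rcons s a = x :: u & p = u ++ r.
Proof.
case: s => [|b s] [<- ->]; first by exists [::].
by exists (rcons s a); rewrite ?cat_rcons.
Qed.

(** The two paths agree up to the place of the move; there the lifted paths
   reach the same coset again, because the move is a homotopy, and from then on
   they agree. *)
Lemma move_lift p r : path (edge X) x p -> path (edge X) x r ->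
  move X (x :: p) (x :: r) -> move coset_cover (full_lift p) (full_lift r).
Proof.
move=> xp xr m.
move: {-2}(x :: p) {-2}(x :: r) (erefl (x :: p)) (erefl (x :: r)) m => S T eS eT m.
case: S T / m eS eT => [s a t|s a b c t abc] eS eT.
  have [u su pu] := split_at (esym eS); have [u' su' ru] := split_at (esym eT).
  move: su'; rewrite su => -[uu']; rewrite -{u'}uu' in ru.
  have ua : last x u = a by have := congr1 (last x) su; rewrite last_rcons /= => ->.
  rewrite pu ru !full_liftE /=.
  have e : coset (rcons u a) = coset u by rewrite -ua coset_repeat.
  by rewrite e (lift_coset t e); apply: move_repeat.
have [u su pu] := split_at (esym eS); have [u' su' ru] := split_at (esym eT).
move: su'; rewrite su => -[uu']; rewrite -{u'}uu' in ru.
have ua : last x u = a by have := congr1 (last x) su; rewrite last_rcons /= => ->.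
rewrite pu ru !full_liftE /=.
have e : coset (rcons (rcons u b) c) = coset (rcons u c).
  by apply: coset_triangle; rewrite ua.
rewrite e (lift_coset t e); apply: move_triangle.
have xub : path (edge X) x (rcons u b).
  by move: xp; rewrite pu -cat_rcons cat_path => /andP[].
have xuc : path (edge X) x (rcons u c).
  by move: xr; rewrite ru -cat_rcons cat_path => /andP[].
apply: flag_face3 flag_cover _ _ _; apply/edge_cover.
- by exists u, b.
- by exists u, c.
exists (rcons u b), c; split=> //; rewrite rcons_path xub last_rcons.
by apply: (face_edge abc); rewrite !inE eqxx ?orbT.
Qed.

Lemma moves_lift p r : path (edge X) x p -> path (edge X) x r ->
  moves X (x :: p) (x :: r) -> moves coset_cover (full_lift p) (full_lift r).
Proof.
by move=> xp xr /asboolP[m|m]; apply/asboolP; [left|right]; apply: move_lift.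
Qed.

End Cover.

(** * Finite data carrying a presentation *)

(** Loops representing the generators, and a finite list of edge paths among
   which every relator contracts, such that only the consequences of the
   relators contract in the complex.  All of this is stable under lifting to a cover, which keeps the
   number of listed points, and under passing to the full subcomplex on them. *)
Record carries (n : nat) (R : seq (word n)) (V : choiceType) (X : complex V)
    (x : V) (q : 'I_n -> seq V) (L : seq (seq V)) : Prop := Carries {
  carries_base : vertex X x;
  carries_gen : forall i, q i \in L;
  carries_path : forall p, p \in L -> path (edge X) x p;
  carries_last : forall i, last x (q i) = x;
  carries_rel : forall r, r \in R -> exists c,
    [/\ {subset c <= map (cons x) L},
        path (moves X) (x :: word_path x q r) c &
        last (x :: word_path x q r) c = [:: x]];
  carries_inj : forall w, homotopic X (x :: word_path x q w) [:: x] ->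
    presents_eq R w [::] }.

Definition support (V : choiceType) (x : V) (L : seq (seq V)) : seq V :=
  x :: flatten L.

Section Carries.
Variables (n : nat) (R : seq (word n)) (V : choiceType) (X : complex V).
Variables (x : V) (q : 'I_n -> seq V) (L : seq (seq V)).
Hypothesis cX : carries R X x q L.

Lemma carries_loop i : is_loop X x (q i).
Proof.
by rewrite /is_loop (carries_last cX) eqxx (carries_path cX) ?(carries_gen cX).
Qed.

Lemma support_word w a : a \in x :: word_path x q w -> a \in support x L.
Proof.
rewrite !inE => /predU1P[->|/word_path_sub[->|[i ai]]]; rewrite ?eqxx //.
apply/orP; right; apply/flattenP; exists (q i) => //.
exact: carries_gen cX i.
Qed.

Lemma support_path p a : p \in L -> a \in x :: p -> a \in support x L.
Proof.
move=> pL; rewrite !inE => /predU1P[->|ap]; rewrite ?eqxx //.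
by apply/orP; right; apply/flattenP; exists p.
Qed.

Lemma carries_relator_hom r : r \in R ->
  homotopic X (x :: word_path x q r) [:: x].
Proof. by move=> /(carries_rel cX)[c [_ /chain_homotopic + <-]]. Qed.

Notation Z := (full_subcomplex X (fun a => a \in support x L)).

Lemma moves_full s t :
  (forall a, a \in s -> a \in support x L) ->
  (forall a, a \in t -> a \in support x L) ->
  moves X s t -> moves Z s t.
Proof.
have mZ s' t' : (forall a, a \in s' -> a \in support x L) ->
    move X s' t' -> move Z s' t'.
  move=> sS m; case: s' t' / m sS => [p a r|p a b c r abc] sS.
    exact: move_repeat.
  apply: move_triangle; split=> // d /in_triple dE; apply: sS.
  by rewrite mem_cat !inE; case: dE => ->; rewrite eqxx ?orbT.
by move=> sS tS /asboolP[m|m]; apply/asboolP; [left|right]; apply: mZ.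
Qed.

Lemma path_full y p : (forall a, a \in y :: p -> a \in support x L) ->
  path (edge X) y p -> path (edge Z) y p.
Proof.
elim: p y => //= b p IH y yS /andP[yb bp]; apply/andP; split.
  apply/edge_full; split=> //; apply: yS; rewrite !inE eqxx ?orbT //.
by apply: IH => // a ap; apply: yS; rewrite inE ap orbT.
Qed.

Lemma carries_full : carries R Z x q L.
Proof.
split.
- split; first exact: carries_base cX.
  by move=> a /fset1P ->; rewrite inE eqxx.
- exact: carries_gen cX.
- move=> p pL; apply: path_full (carries_path cX pL).
  by move=> a; apply: support_path.
- exact: carries_last cX.
- move=> r rR; have [c [cL mc lc]] := carries_rel cX rR.
  exists c; split=> //.
  have : forall a, a \in x :: word_path x q r -> a \in support x L.
    exact: support_word.
  elim: c (x :: word_path x q r) cL mc {lc} => //= t c IH s cL /andP[st tc] sS.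
  have tS a : a \in t -> a \in support x L.
    have /mapP[p pL ->] : t \in map (cons x) L by apply: cL; rewrite inE eqxx.
    exact: support_path.
  rewrite moves_full //=; apply: IH => // u uc; apply: cL.
  by rewrite inE uc orbT.
- move=> w h; apply: (carries_inj cX).
  rewrite -[x :: _]map_id -[[:: x]]map_id; apply: homotopic_map h.
  by move=> a b c [].
Qed.

Lemma support_connected a : a \in support x L ->
  exists2 p, path (edge X) x p & last x p = a.
Proof.
rewrite inE => /predU1P[->|/flattenP[p pL ap]]; first by exists [::].
have xp := carries_path cX pL; case/splitPr: ap xp => p1 p2.
rewrite -cat_rcons cat_path => /andP[xp1 _].
by exists (rcons p1 a); rewrite ?last_rcons.
Qed.

(** * Lifting the data *)

(** The subgroup generated by the given loops, up to homotopy. *)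
Definition word_loops (g : seq V) : Prop := exists w, g = word_path x q w.

Lemma word_loops1 : word_loops [::]. Proof. by exists [::]. Qed.

Lemma word_loopsM g h : word_loops g -> word_loops h -> word_loops (g ++ h).
Proof. by move=> [v ->] [w ->]; exists (v ++ w); rewrite word_path_cat. Qed.

Lemma word_loopsV g : word_loops g -> word_loops (rev (belast x g)).
Proof.
by move=> [w ->]; exists (word_inv w); rewrite (word_path_inv carries_loop).
Qed.

Lemma word_loopsP g : word_loops g -> is_loop X x g.
Proof. by move=> [w ->]; apply: word_path_loop carries_loop w. Qed.

Hypothesis flagX : flag X.

Notation C := (coset_cover X x word_loops).
Notation cst := (coset X x word_loops).
Notation lft := (lift_path X x word_loops).

Lemma carries_cover :
  carries R C (cst [::]) (fun i => lft [::] (q i)) (map (lft [::]) L).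
Proof.
have W1 := word_loops1; have WM := word_loopsM; have WV := word_loopsV.
have WP := word_loopsP; have vx := carries_base cX.
have full : locally_full C X (cover_proj x) by apply: cover_locally_full.
have pathL p : path (edge X) x p -> path (edge C) (cst [::]) (lft [::] p).
  by move=> xp; apply: path_lift.
have last_gen i : last (cst [::]) (lft [::] (q i)) = cst [::].
  rewrite last_lift; apply/cosetP => //; exists (q i); last first.
    by rewrite cats0; apply: homotopic_refl.
  by exists [:: (i, false)]; rewrite /word_path /= cats0.
have loopC i : is_loop C (cst [::]) (lft [::] (q i)).
  rewrite /is_loop last_gen eqxx andbT; apply: pathL.
  exact: (carries_path cX (carries_gen cX i)).
have projC w : map (cover_proj x)
    (word_path (cst [::]) (fun i => lft [::] (q i)) w) = word_path x q w.
  rewrite map_word_path cover_projE //; congr (word_path _ _ _).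
  by apply/funext=> i; rewrite map_lift.
have liftC w : word_path (cst [::]) (fun i => lft [::] (q i)) w =
    lft [::] (word_path x q w).
  rewrite -projC; apply: lift_unique => //.
  by case/andP: (word_path_loop loopC w).
split=> //.
- exact: vertex_cover.
- by move=> i; apply/map_f/(carries_gen cX).
- by move=> p /mapP[p' /(carries_path cX)/pathL + ->].
- move=> r rR; have [c [cL mc lc]] := carries_rel cX rR.
  exists (map (fun s => full_lift X x word_loops (behead s)) c); split.
  + move=> t /mapP[s /cL/mapP[p pL ->] ->]; apply/mapP.
    by exists (lft [::] p); rewrite ?map_f.
  + rewrite liftC.
    have : path (edge X) x (word_path x q r).
      by case/andP: (word_path_loop carries_loop r).
    elim: c (word_path x q r) cL mc {lc} => //= t c IH p cL /andP[pt tc] xp.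
    have /mapP[p' pL te] : t \in map (cons x) L by apply: cL; rewrite inE eqxx.
    have xp' := carries_path cX pL.
    rewrite te in pt tc *; rewrite moves_lift //=; apply: IH => // u uc.
    by apply: cL; rewrite inE uc orbT.
  + rewrite liftC (last_map (fun s => full_lift X x word_loops (behead s)) c
      (x :: word_path x q r)).
    by rewrite lc.
- move=> w /(homotopic_map (fun a b c => locally_full_face3 full flagX)).
  by rewrite /= projC cover_projE //; apply: carries_inj cX w.
Qed.

Lemma support_cover :
  map (cover_proj x) (support (cst [::]) (map (lft [::]) L)) = support x L.
Proof.
have W1 := word_loops1; have WM := word_loopsM; have WV := word_loopsV.
have WP := word_loopsP.
rewrite /support /= cover_projE // map_flatten -map_comp.
by congr (_ :: flatten _); apply: map_id_in => p _ /=; apply: map_lift.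
Qed.

End Carries.

(** * The complexity of a supported complex *)

(** The list has one entry for each visit of a vertex.  Equal entries count
   twice, being joined by a degenerate edge, so that both the separation of
   two visits of a vertex and the loss of an edge lower this number. *)
Definition complexity (V : choiceType) (X : complex V) (F : seq V) : nat :=
  \sum_(a <- F) \sum_(b <- F) ((a == b) + edge X a b).

Lemma sum_ltn (T : eqType) (r : seq T) (f g : T -> nat) c :
  (forall a, a \in r -> f a <= g a) -> c \in r -> f c < g c ->
  \sum_(a <- r) f a < \sum_(a <- r) g a.
Proof.
elim: r => // a r IH fg; rewrite !big_cons inE => /predU1P[->|cr] fgc.
  rewrite -addSn; apply: leq_add => //.
  by rewrite !big_seq; apply: leq_sum => b br; apply: fg; rewrite inE br orbT.
rewrite -addnS; apply: leq_add; first by apply: fg; rewrite inE eqxx.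
by apply: IH => // b br; apply: fg; rewrite inE br orbT.
Qed.

(** If a map of complexes does not lower the complexity, then it is injective
   on the listed points and creates no edge between them. *)
Lemma complexity_map (V W : choiceType) (X : complex V) (Y : complex W)
    (f : V -> W) (F : seq V) :
  (forall a b, edge X a b -> edge Y (f a) (f b)) ->
  complexity X F < complexity Y (map f F) \/
  (forall a b, a \in F -> b \in F ->
    (f a = f b -> a = b) /\ (edge Y (f a) (f b) -> edge X a b)).
Proof.
move=> fE; rewrite /complexity big_map.
have le a b : (a == b) + edge X a b <= (f a == f b) + edge Y (f a) (f b).
  apply: leq_add; first by case: eqP => [->|]; rewrite ?eqxx.
  by case: (boolP (edge X a b)) => [/fE->|].
under [X in _ < X]eq_bigr do rewrite big_map.
have les a : \sum_(b <- F) ((a == b) + edge X a b) <=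
    \sum_(b <- F) ((f a == f b) + edge Y (f a) (f b)) by apply: leq_sum.
have [[a [b [aF bF ab]]]|no] := pselect (exists a b, [/\ a \in F, b \in F &
    (a == b) + edge X a b < (f a == f b) + edge Y (f a) (f b)]).
  left; apply: (sum_ltn (c := a)) => //.
  exact: (sum_ltn (c := b)).
right=> a b aF bF.
have {no} : ~~ ((a == b) + edge X a b < (f a == f b) + edge Y (f a) (f b)).
  by apply/negP=> h; apply: no; exists a, b.
rewrite -leqNgt => h.
have eXY : edge X a b -> edge Y (f a) (f b) := fE a b.
have eab : a == b -> f a == f b by move=> /eqP->.
have [e1 e2] : (f a == f b) = (a == b) /\ edge Y (f a) (f b) = edge X a b.
  move: (a == b) (f a == f b) (edge X a b) (edge Y (f a) (f b)) h eXY eab.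
  by do 4![case] => h h1 h2; try (by split); have := (h1, h2); lia.
by split=> [/eqP|]; rewrite ?e1 ?e2 // => /eqP.
Qed.

(** * Fundamental groups of supported complexes *)

Lemma multiplicative1 (G H : groupType) (f : {multiplicative G -> H}) :
  f 1%g = 1%g.
Proof. by apply: (mulgI (f 1%g)); rewrite -gmulfM !mulg1. Qed.

Lemma multiplicativeV (G H : groupType) (f : {multiplicative G -> H}) a :
  f (a^-1)%g = ((f a)^-1)%g.
Proof.
by apply: (mulgI (f a)); rewrite -gmulfM !mulgV multiplicative1.
Qed.

Lemma multiplicative_inj (G H : groupType) (f : {multiplicative G -> H}) :
  (forall a, f a = 1%g -> a = 1%g) -> injective f.
Proof.
move=> f1 a b ab; apply: divg1_eq; apply: f1.
by rewrite gmulfM multiplicativeV ab mulgV.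
Qed.

Section Presented.
Variables (n : nat) (R : seq (word n)) (V : choiceType) (X : complex V).
Variables (x : V) (q : 'I_n -> seq V).
Hypothesis ql : forall i, is_loop X x (q i).

Definition word_loop (w : word n) : loop X x :=
  exist _ (word_path x q w) (word_path_loop ql w).

Lemma pi_word_cat v w : \pi_(pi1 X x) (word_loop (v ++ w)) =
  (\pi_(pi1 X x) (word_loop v) * \pi_(pi1 X x) (word_loop w))%g.
Proof.
rewrite [RHS]pi1_mulE; congr (\pi_(pi1 X x) _); apply: val_inj => /=.
exact: word_path_cat.
Qed.

(** The three hypotheses say that the homomorphism sending the generators to the
   given loops is well defined, injective and surjective. *)
Lemma presented_isomorphic :
  (forall r, r \in R -> homotopic X (x :: word_path x q r) [:: x]) ->
  (forall w, homotopic X (x :: word_path x q w) [:: x] -> presents_eq R w [::]) ->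
  (forall p, is_loop X x p ->
     exists w, homotopic X (x :: p) (x :: word_path x q w)) ->
  group_isomorphic (presented R) (pi1 X x).
Proof.
move=> hR inj surj.
pose phi (a : presented R) : pi1 X x := \pi_(pi1 X x) (word_loop (repr a)).
have phiE w : phi (\pi_(presented R) w) = \pi_(pi1 X x) (word_loop w).
  apply/pi1P; apply: (homotopic_word_path ql hR); exact: presents_repr.
have phiM : {morph phi : a b / (a * b)%g >-> (a * b)%g}.
  elim/quotW=> v; elim/quotW=> w; rewrite [(_ * _)%g in LHS]presented_mulE !phiE.
  exact: pi_word_cat.
pose mphi := isMultiplicative.Build (presented R) (pi1 X x) phi phiM.
pose f : {multiplicative presented R -> pi1 X x} := HB.pack phi mphi.
exists f.
have phi_inj : injective f.
  apply: (@multiplicative_inj _ _ f); elim/quotW=> w.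
  rewrite /f /= phiE => /pi1P /inj h.
  by apply/presentedP.
have [g gK] : {g : pi1 X x -> presented R & forall b, f (g b) = b}.
  apply: (choice (P := fun b a => f a = b)); elim/quotW=> p.
  have [w h] := surj _ (valP p); exists (\pi_(presented R) w).
  by rewrite /f /= phiE; apply/pi1P/homotopic_sym.
by exists g => // a; apply: phi_inj; rewrite gK.
Qed.

End Presented.

Lemma group_isomorphic_quotient (G H K : groupType) :
  group_isomorphic G H -> group_isomorphic G K -> group_isomorphic H K.
Proof.
move=> [f [f' fK f'K]] [g gbij].
have hM : {morph g \o f' : a b / (a * b)%g >-> (a * b)%g}.
  by move=> a b; rewrite /= (can2_gmulfM fK f'K) gmulfM.
pose m := isMultiplicative.Build H K (g \o f') hM.
exists (HB.pack (g \o f') m : {multiplicative H -> K}) => /=.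
by apply: bij_comp => //; exists f.
Qed.

Lemma finite_supported (V : choiceType) (X : complex V) (F : seq V) :
  finite_complex (full_subcomplex X (fun a => a \in F)).
Proof.
apply: (@sub_finite_set _ _ [set` fpowerset [fset a in F]]%classic).
  move=> s [_ sF] /=; rewrite fpowersetE; apply/fsubsetP=> a /sF.
  by rewrite !inE.
exact: finite_fset.
Qed.

Lemma connected_supported n (R : seq (word n)) (V : choiceType)
    (X : complex V) x q L :
  carries R X x q L ->
  connected (full_subcomplex X (fun a => a \in support x L)).
Proof.
set Z := full_subcomplex _ _; move=> /carries_full cZ; split.
  by exists x; apply: carries_base cZ.
move=> a b [_ aF] [_ bF].
have [p xp pa] := support_connected cZ (aF a (fset11 a)).
have [r xr rb] := support_connected cZ (bF b (fset11 b)).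
have lx : last a (rev (belast x p)) = x.
  by case: p pa {xp} => [|c p] //= _; rewrite rev_cons last_rcons.
exists (rev (belast x p) ++ r); last by rewrite last_cat lx.
rewrite cat_path lx xr andbT -pa rev_path -(eq_path (e := edge Z)) // => u v.
exact: edgeC.
Qed.

(** The full subcomplex on the listed points either has no other loops, up to
   homotopy, than the given ones, or the cover attached to these loops carries
   the lifted data with a smaller complexity. *)
Lemma carries_reduce k n (R : seq (word n)) m (V : choiceType) (X : complex V)
    x (q : 'I_n -> seq V) L :
  hub_condition k X -> carries R X x q L ->
  complexity X (support x L) <= m ->
  exists (W : choiceType) (Y : complex W) (y : W),
    [/\ connected Y, finite_complex Y, hub_condition k Y, vertex Y y
      & group_isomorphic (presented R) (pi1 Y y)].
Proof.
elim: m V X x q L => [|m IH] V X x q L hX cX cm; first last.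
  pose F := support x L; pose Z := full_subcomplex X (fun a => a \in F).
  have cZ : carries R Z x q L := carries_full cX.
  have [fX _ _] := hX; have fZ : flag Z by apply: full_flag.
  have hZ : hub_condition k Z.
    exact: hub_condition_pullback fZ (locally_full_full X _) hX.
  pose G := word_loops x q; pose C := coset_cover Z x G.
  have W1 := word_loops1 x q; have WM := @word_loopsM _ _ x q.
  have WV := word_loopsV cZ; have WP := word_loopsP cZ.
  have vx := carries_base cZ.
  have CZ : locally_full C Z (cover_proj x) by apply: cover_locally_full.
  have [edgeCZ injCZ _] := CZ; have cC := carries_cover cZ fZ.
  have hC : hub_condition k C.
    by apply: hub_condition_pullback CZ hZ; apply: flag_cover.
  have := support_cover cZ; rewrite -/F -/G.
  set F' := support _ _ => F'F.
  have [lt|same] := complexity_map F' edgeCZ.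
    apply: (IH _ _ _ _ _ hC cC); rewrite -ltnS; apply: leq_trans lt _.
    rewrite F'F; apply: leq_trans cm; apply: leq_sum => a _; apply: leq_sum => b _.
    rewrite leq_add2l; case: (boolP (edge Z a b)) => // /edge_full[-> //].
  exists V, Z, x; split=> //.
  - exact: connected_supported cX.
  - exact: finite_supported.
  apply: (presented_isomorphic (carries_loop cZ)).
  - by move=> r; apply: carries_relator_hom cZ r.
  - exact: carries_inj cZ.
  move=> p lp; have /andP[xp /eqP px] := lp.
  (* As every vertex of Z is listed and the projection is bijective on the
     listed points and on their edges, a path of Z can be lifted step by step
     inside the listed points; the lift of a loop is then closed. *)
  have cp : coset Z x G p \in F'.
    elim/last_ind: p xp {lp px} => [|p a IHp] xp; first by rewrite inE eqxx.
    move: (xp); rewrite rcons_path => /andP[/IHp pF' pa].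
    have aF : a \in F by have /edge_full[] := pa.
    move: aF; rewrite -F'F => /mapP[c cF' ac].
    have pc : edge C (coset Z x G p) c.
      by apply/(same _ _ pF' cF').2; rewrite cover_projE // -ac.
    suff <- : c = coset Z x G (rcons p a) by [].
    apply: injCZ pc _ _; first by apply/edge_cover => //; exists p, a.
    by rewrite cover_projE // last_rcons.
  have F'0 : coset Z x G [::] \in F' by rewrite inE eqxx.
  have /cosetP : coset Z x G p = coset Z x G [::].
    by apply: (same _ _ cp F'0).1; rewrite !cover_projE.
  case=> // g [w ->]; rewrite cats0; by exists w.
(* The base point is listed and equal to itself, so the complexity is not 0. *)
exfalso; move: cm; rewrite leqn0 /complexity /support !big_cons.
by rewrite eqxx.
Qed.

Theorem theorem8p7 (k : nat) (hk : 6 <= k)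
    (V : choiceType) (X : complex V) (hconn : connected X)
    (hcompact : finite_complex X) (hX : SD2star_links k X)
    (x : V) (hx : vertex X x)
    (P : pred (pi1 X x)) (H : subGroupType P) (hH : finitely_presented H) :
  exists (W : choiceType) (Y : complex W) (y : W),
    [/\ connected Y, finite_complex Y, SD2star_links k Y, vertex Y y
      & group_isomorphic (pi1 Y y) H].
Proof.
have hub := hub_condition_of_links hcompact hX.
have [n [R fH]] := hH; have [f [f' fK f'K]] := fH.
pose gen i : loop X x := repr (val (f (\pi_(presented R) [:: (i, false)]))).
pose q i : seq V := val (gen i).
have ql i : is_loop X x (q i) := valP (gen i).
have pi_word w : \pi_(pi1 X x) (word_loop ql w) = val (f (\pi_(presented R) w)).
  have pi_cons a v : \pi_(presented R) (a :: v) =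
      (\pi_(presented R) [:: a] * \pi_(presented R) v)%g.
    by rewrite [RHS]presented_mulE.
  elim: w => [|a w IH].
    transitivity (1%g : pi1 X x); last first.
      by rewrite -[\pi_(presented R) [::]]/(1%g : presented R) multiplicative1 val1.
    by apply/pi1P/homotopic_refl.
  rewrite pi_cons gmulfM valM -IH -cat1s pi_word_cat; congr (_ * _)%g.
  case: a => i [].
    have -> : \pi_(presented R) [:: (i, true)] =
        ((\pi_(presented R) [:: (i, false)])^-1)%g.
      by rewrite [RHS]presented_invE.
    rewrite multiplicativeV gmulfV.
    transitivity ((\pi_(pi1 X x) (gen i))^-1)%g; last by rewrite reprK.
    rewrite [RHS]pi1_invE.
    by congr (\pi_(pi1 X x) _); apply: val_inj; rewrite /= /word_path /= cats0.
  transitivity (\pi_(pi1 X x) (gen i)); last by rewrite reprK.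
  by congr (\pi_(pi1 X x) _); apply: val_inj; rewrite /= /word_path /= cats0.
have null w : homotopic X (x :: word_path x q w) [:: x] <-> presents_eq R w [::].
  rewrite presentedP -[\pi_(presented R) [::]]/(1%g : presented R).
  transitivity (\pi_(pi1 X x) (word_loop ql w) = (1%g : pi1 X x)).
    by rewrite -(pi1P (word_loop ql w) (loop_one X x)).
  rewrite pi_word; split=> [e|->]; last by rewrite multiplicative1 val1.
  apply: (can_inj fK); rewrite multiplicative1; apply: val_inj; by rewrite e val1.
have [c cP] : {c : word n -> seq (seq V) & forall r, r \in R ->
    path (moves X) (x :: word_path x q r) (c r) /\
    last (x :: word_path x q r) (c r) = [:: x]}.
  apply: (choice (P := fun r cr => r \in R ->
    path (moves X) (x :: word_path x q r) cr /\
    last (x :: word_path x q r) cr = [:: x])) => r.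
  have [rR|_] := boolP (r \in R); last by exists [::].
  have /null/homotopic_chain[cr] : presents_eq R r [::].
    by have := presents_relator [::] [::] rR; rewrite cats0.
  by exists cr.
(* The listed paths: the generators and all steps of the contractions. *)
pose L := map q (enum 'I_n) ++ flatten (map (fun r => map behead (c r)) R).
have chainP r t : r \in R -> t \in c r ->
    exists2 p, t = x :: p & path (edge X) x p.
  move=> rR; apply: (chain_base (p := word_path x q r)) => //.
    by case/andP: (word_path_loop ql r).
  by case: (cP r rR).
have cX : carries R X x q L.
  split=> //.
  - by move=> i; rewrite mem_cat map_f ?mem_enum.
  - move=> p; rewrite mem_cat => /orP[/mapP[i _ ->]|].
      by case/andP: (ql i).
    case/flattenP=> s /mapP[r rR ->] /mapP[t /(chainP r t rR)[p' -> xp'] ->].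
    exact: xp'.
  - by move=> i; case/andP: (ql i) => _ /eqP.
  - move=> r rR; have [pc lc] := cP r rR; exists (c r); split=> // t tc.
    have [p te _] := chainP r t rR tc; rewrite te; apply: map_f.
    rewrite mem_cat; apply/orP; right; apply/flattenP.
    exists (map behead (c r)); first exact: map_f.
    by rewrite te in tc; apply/mapP; exists (x :: p).
  - by move=> w /null.
have [W [Y [y [cY fY hY vy iso]]]] := carries_reduce hub cX (leqnn _).
exists W, Y, y; split=> //; first exact: SD2star_links_of_hub_condition.
exact: group_isomorphic_quotient iso fH.
Qed.
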